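(* Let $\mathcal{H}$ and $\mathcal{K}$ be real Hilbert spaces, let $T \in \mathcal{B}(\mathcal{H},\mathcal{K})$ be injective with closed range, and let $\mathrm{Prox}\colon \mathcal{K} \to \mathcal{K}$ be a proximity operator on $\mathcal{K}$. Then the operator $T^\dagger \, \mathrm{Prox} \, T \colon \mathcal{H}_T \to \mathcal{H}_T$ is a proximity operator on the Hilbert space $\mathcal{H}_T$.
   Context: $\mathcal{B}(\mathcal{H},\mathcal{K})$ denotes the bounded linear operators from $\mathcal{H}$ to $\mathcal{K}$ (with domain all of $\mathcal{H}$). For a real Hilbert space $X$ with norm $\|\cdot\|_X$, $\Gamma_0(X)$ is the set of proper, convex, lower semi-continuous functions $X \to (-\infty,\infty]$. For $f \in \Gamma_0(X)$ the proximity operator of $f$ on $X$ is $\mathrm{prox}_f\colon X \to X$, $\mathrm{prox}_f(x) = \operatorname{argmin}_{y \in X} \{ \frac12 \|x-y\|_X^2 + f(y) \}$ (the unique minimizer). An operator $X \to X$ is called a proximity operator on $X$ if it equals $\mathrm{prox}_f$ for some $f \in \Gamma_0(X)$; this notion depends on the inner product of $X$. For injective $T \in \mathcal{B}(\mathcal{H},\mathcal{K})$ with closed range, the Moore-Penrose inverse is $T^\dagger = (T^*T)^{-1}T^* \in \mathcal{B}(\mathcal{K},\mathcal{H})$, where $T^*$ is the adjoint with respect to the original inner products of $\mathcal{H}$ and $\mathcal{K}$. $\mathcal{H}_T$ denotes the linear space $\mathcal{H}$ equipped with the inner product $\langle x,y\rangle_{\mathcal{H}_T} = \langle Tx,Ty\rangle_{\mathcal{K}}$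 and norm $\|x\|_{\mathcal{H}_T} = \|Tx\|_{\mathcal{K}}$; this norm is equivalent to $\|\cdot\|_{\mathcal{H}}$, so $\mathcal{H}_T$ is a Hilbert space. *)

(* Defs.v *)
From HB Require Import structures.
From mathcomp Require Import all_boot all_order all_algebra.
From mathcomp Require Import all_classical all_reals all_analysis.

Set Implicit Arguments.
Unset Strict Implicit.
Unset Printing Implicit Defensive.

Import Order.TTheory GRing.Theory Num.Theory.
Import numFieldNormedType.Exports.

Local Open Scope classical_set_scope.
Local Open Scope ring_scope.

HB.mixin Record NormedModule_hasInner (R : realType) V
    & NormedModule R V := {
  inner : {dot V for (@idfun R)} ;
  inner_normE : forall x : V, inner x x = `|x| ^+ 2
}.

#[short(type="hilbertType")]
HB.structure Definition Hilbert (R : realType) :=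
  {V of CompleteNormedModule R V & NormedModule_hasInner R V}.

Section Operators.
Context {R : realType} {H K : hilbertType R}.
Implicit Type T : H -> K.

Definition bounded_operator T := exists M : R, forall x, `|T x| <= M * `|x|.

(* When T is linear and bounded, the set below is a singleton for every y, by
   the Riesz representation theorem. *)
Definition adjoint T : K -> H :=
  fun y => get [set z : H | forall x : H, inner (T x) y = inner x z].

(* [pinv [set: H] f] is the inverse function of f when f is bijective. *)
Definition moore_penrose T : K -> H :=
  pinv [set: H] (adjoint T \o T) \o adjoint T.

End Operators.

Section ProximityOperators.
Context {R : realType} {X : hilbertType R}.
Local Open Scope ereal_scope.

Definition proper_function (f : X -> \bar R) :=
  (forall x, f x != -oo) /\ (exists x, f x != +oo).

(* For t = 0 and t = 1 the inequality is trivial, since 0 * +oo = 0 in \bar R;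
   +oo and -oo are never added when f is proper. *)
Definition convex_efunction (f : X -> \bar R) :=
  forall (t : R) (x y : X), (0 <= t <= 1)%R ->
    f (t *: x + (1 - t) *: y)%R <= t%:E * f x + (1 - t)%:E * f y.

Definition Gamma0 : set (X -> \bar R) :=
  [set f | [/\ proper_function f, convex_efunction f & lower_semicontinuous f]].

Definition argmin (g : X -> \bar R) : set X :=
  [set p | forall y, g p <= g y].

(* For f in Gamma0 the objective has exactly one minimizer, which [get]
   returns. *)
Definition prox (f : X -> \bar R) : X -> X :=
  fun x => get (argmin (fun y => (2^-1 * `|x - y| ^+ 2)%:E + f y)).

Definition is_proximity_operator (P : X -> X) :=
  exists2 f, Gamma0 f & P = prox f.

End ProximityOperators.

Arguments is_proximity_operator {R} X P.

(* The linear space H with the inner product <Tx, Ty>; its norm and topology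
   are those of this inner product, not those of H. *)
Definition renormed (R : realType) (H K : hilbertType R) (T : {linear H -> K})
  (Tinj : injective T) (Tcl : closed (range T)) : Type := H.

Section Renormed.
Context {R : realType} {H K : hilbertType R} {T : {linear H -> K}}.
Context {Tinj : injective T} {Tcl : closed (range T)}.
Let HT := renormed Tinj Tcl.

HB.instance Definition _ := GRing.Lmodule.copy HT H.

Let normT (x : HT) : R := `|T x|.

Let ler_normTD (x y : HT) : normT (x + y) <= normT x + normT y.
Proof. by rewrite /normT linearD ler_normD. Qed.

Let normTZ (l : R) (x : HT) : normT (l *: x) = `|l| * normT x.
Proof. by rewrite /normT linearZ normrZ. Qed.

Let normT_eq0 (x : HT) : normT x = 0 -> x = 0.
Proof.
by move=> /normr0_eq0 Tx0; apply: Tinj; rewrite Tx0 linear0.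
Qed.

HB.instance Definition _ :=
  Lmodule_isNormed.Build R HT ler_normTD normTZ normT_eq0.

Lemma renormed_normE (x : HT) : `|x| = `|T x|.
Proof. by []. Qed.

Let HT_complete (F : set_system HT) : ProperFilter F -> cauchy F -> cvg F.
Proof.
move=> FF cF; pose TF : set_system K := (T : HT -> K) @ F.
have TFF : ProperFilter TF by exact: fmap_proper_filter.
have cTF : cauchy TF.
  apply/cauchyP => e e0; have [x Fx] := (cauchyP F).1 cF e e0.
  exists (T x); apply: (@filterS _ F _ _ _ _ Fx) => z /=.
  by rewrite -!ball_normE /= renormed_normE linearB.
have /cvg_ex[y Ty] := @cauchy_cvg K TF TFF cTF.
have [x _ Txy] : range T y.
  apply: (@closed_cvg _ _ F _ (T : HT -> K) (range T)) => //.
  by apply: nearW => z; exists z.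
apply/cvg_ex; exists (x : HT); apply/cvgrPdist_lt => e e0.
have /cvgrPdist_lt/(_ e e0) := Ty; apply: filterS => z /=.
by rewrite renormed_normE linearB Txy.
Qed.

HB.instance Definition _ := Uniform_isComplete.Build HT HT_complete.

Definition innerT (x y : HT) : R := inner (T x) (T y).

Let innerTDl (u' : HT) : zmod_morphism (innerT ^~ u').
Proof. by move=> x y; rewrite /innerT linearB linearBl. Qed.

Let innerTDr (u : HT) : zmod_morphism (innerT u).
Proof. by move=> x y; rewrite /innerT linearB linearBr. Qed.

Let innerTZl (u' : HT) : scalable_for *%R (innerT ^~ u').
Proof. by move=> a x; rewrite /innerT linearZ linearZl_LR. Qed.

Let innerTZr (u : HT) : scalable_for (idfun \; *%R) (innerT u).
Proof. by move=> a x; rewrite /innerT linearZ linearZr. Qed.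

HB.instance Definition _ := isBilinear.Build R HT HT R *%R (idfun \; *%R)
  innerT innerTDl innerTDr innerTZl innerTZr.

Let innerT_sym (x y : HT) : innerT x y = (-1) ^+ false * idfun (innerT y x).
Proof. exact: hermC. Qed.

HB.instance Definition _ :=
  isHermitianSesquilinear.Build R HT false idfun innerT innerT_sym.

Let innerT_gt0 (x : HT) : x != 0 -> 0 < innerT x x.
Proof.
by move=> x0; rewrite /innerT inner_normE exprn_gt0// -renormed_normE normr_gt0.
Qed.

HB.instance Definition _ := isDotProduct.Build R HT innerT innerT_gt0.

Let innerT_normE (x : HT) : innerT x x = `|x| ^+ 2.
Proof. exact: inner_normE. Qed.

HB.instance Definition _ :=
  NormedModule_hasInner.Build R HT innerT_normE.

Lemma renormed_innerE (x y : HT) : inner x y = inner (T x) (T y).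
Proof. by []. Qed.

End Renormed.

(* Main.v *)
Require Import Defs.
From mathcomp Require Import all_boot all_order all_algebra.
From mathcomp Require Import all_classical all_reals all_analysis.
From mathcomp Require Import ring lra.

(** For f in Gamma0(K) let e be its Moreau envelope, the minimal value of
    |x - y|^2 / 2 + f y over y. It is convex, |x|^2 / 2 - e x is convex as
    well, and the gradient of e at x is x - prox_f x. For a pair (e, A) these
    facts amount to the two bounds
      e x + <x - A x, z - x> <= e z
                             <= e x + <x - A x, z - x> + |z - x|^2 / 2,
    called [envelope_pair e A] below. The theorem rests on three facts.

    - [prox_envelope]: f in Gamma0 yields an envelope pair (e, prox_f). This
      requires that proximal points exist ([prox_exists]).
    - [envelope_prox]: conversely, in every envelope pair (e, A) the map A is
      a proximity operator. This is Moreau's characterization of proximity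
      operators. The function is written down explicitly, as a supremum of
      affine functions, so that convexity and semi-continuity are free.
    - The bounds survive precomposition of e with T. The inner product
      <Tx - Prox (Tx), Tz - Tx> of K equals <x - B x, z - x> in H_T, with
      B = T^+ Prox T, because T (T^+ y) and y have the same inner products
      with the range of T ([moore_penroseP]).

    The adjoint and the Moore-Penrose inverse are chosen by a description, so
    they have to be shown to exist. Both existence claims are instances of the
    Riesz representation theorem, on H and on H_T respectively. That theorem
    is obtained from proximal points too: the vector representing l minimizes
    |y|^2 / 2 - l y. Using Riesz on H_T, rather than inverting T^*T on all of
    H, makes the open mapping theorem unnecessary. *)

Set Implicit Arguments.
Unset Strict Implicit.
Unset Printing Implicit Defensive.

Import Order.TTheory GRing.Theory Num.Theory.
Import numFieldNormedType.Exports.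

Local Open Scope classical_set_scope.
Local Open Scope ring_scope.

(** * Inner products *)

Section InnerProduct.
Context {R : realType} {X : hilbertType R}.
Implicit Types x y z : X.

Lemma innerC x y : inner x y = inner y x.
Proof. by rewrite hermC expr0 mul1r. Qed.

Lemma innerE :
  (forall x y z, inner (x + y) z = inner x z + inner y z) *
  (forall x y z, inner x (y + z) = inner x y + inner x z) *
  (forall x y, inner (- x) y = - inner x y) *
  (forall x y, inner x (- y) = - inner x y) *
  (forall t x y, inner (t *: x) y = t * inner x y) *
  (forall t x y, inner x (t *: y) = t * inner x y).
Proof.
do !split=> *; [exact: linearDl|exact: linearDr|exact: linearNl|
  exact: linearNr|exact: linearZl_LR|exact: linearZr].
Qed.

Lemma inner_ge0 x : 0 <= inner x x.
Proof. by rewrite inner_normE sqr_ge0. Qed.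

Lemma inner_ext x y : (forall z, inner z x = inner z y) -> x = y.
Proof.
move=> xy; apply/eqP; rewrite -subr_eq0 -normr_eq0 -sqrf_eq0 -inner_normE.
by apply/eqP; rewrite !innerE !xy; ring.
Qed.

Lemma cauchy_schwarz x y : `|inner x y| <= `|x| * `|y|.
Proof.
rewrite -(@ler_pXn2r _ 2)// ?nnegrE ?mulr_ge0// exprMn -!inner_normE.
rewrite real_normK ?num_real//.
have [->|y0] := eqVneq y 0.
  by rewrite -[0](scale0r (0 : X)) !innerE !mul0r !mulr0 expr0n.
have yy : 0 < inner y y by rewrite inner_normE exprn_gt0// normr_gt0.
(* Up to the factor |y|^2, the component of x orthogonal to y. *)
have := inner_ge0 (inner y y *: x - inner x y *: y).
rewrite !innerE (innerC y x) => h.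
have : 0 <= inner y y * (inner x x * inner y y - inner x y ^+ 2) by nra.
by rewrite pmulr_rge0// subr_ge0.
Qed.

End InnerProduct.

(** * Lower semi-continuity *)

Section LowerSemicontinuity.
Context {R : realType}.

Lemma lsc_lipschitz (X : normedModType R) (M : R) (u : X -> R) :
  (forall x y, `|u y - u x| <= M * `|y - x|) ->
  lower_semicontinuous (fun x => (u x)%:E).
Proof.
move=> uM x a; rewrite lte_fin => aux.
have M0 : 0 < `|M| + 1 by rewrite ltr_wpDl.
exists (ball x ((u x - a) / (`|M| + 1))); first by
  apply: nbhsx_ballx; rewrite divr_gt0// subr_gt0.
move=> y; rewrite -ball_normE /= distrC ltr_pdivlMr// => h.
have := uM x y; rewrite lte_fin ler_norml => /andP[+ _].
by have := normr_ge0 (y - x); have := ler_norm M; nra.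
Qed.

Lemma lsc_sup (X : topologicalType) (I : Type) (f : I -> X -> \bar R) :
  (forall i, lower_semicontinuous (f i)) ->
  lower_semicontinuous (fun x => ereal_sup (range (f^~ x))).
Proof.
move=> lscf x a /ereal_sup_gt[_ [i _ <-]] /lscf[V xV Va]; exists V => // y Vy.
by apply: (lt_le_trans (Va y Vy)); apply: ereal_sup_ubound; exists i.
Qed.

End LowerSemicontinuity.

(** * Existence of proximal points *)

Section ProximalPoints.
Context {R : realType} {X : hilbertType R}.
Implicit Types (f : X -> \bar R) (x y : X).

Lemma Gamma0_fin f y : Gamma0 f -> f y != +oo%E -> f y = (fine (f y))%:E.
Proof. by move=> [[fNy _] _ _] fy; have := fNy y; case: (f y) fy. Qed.

Lemma Gamma0_convex_fin f (t : R) y1 y2 r1 r2 : Gamma0 f -> 0 <= t <= 1 ->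
  f y1 = r1%:E -> f y2 = r2%:E ->
  exists2 s, f (t *: y1 + (1 - t) *: y2) = s%:E & s <= t * r1 + (1 - t) * r2.
Proof.
move=> Gf t01 f1 f2; have [[fNy _] cf _] := Gf.
have := cf t y1 y2 t01; rewrite f1 f2 -!EFinM -EFinD.
case: (f _) (fNy (t *: y1 + (1 - t) *: y2)) => // s _.
by rewrite lee_fin; exists s.
Qed.

(** An elementary substitute for an affine minorant, which would need a
    separation theorem. Near a point x0 of finite value, semi-continuity gives
    f > f x0 - 1; a point y further away is joined to x0 by a segment that
    crosses this neighbourhood, and convexity along the segment limits how
    fast f can decrease, with a slope inverse to the radius. *)
Lemma Gamma0_conic_minorant f : Gamma0 f ->
  exists x0 a b, 0 <= b /\ forall y, ((a - b * `|y - x0|)%:E <= f y)%E.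
Proof.
move=> Gf; have [[_ [x0 fx0]] _ lscf] := Gf.
have fx0E := Gamma0_fin Gf fx0; set r0 := fine (f x0) in fx0E.
have [V /nbhs_ballP[e /= e0 eV] Vr] : exists2 V, nbhs x0 V &
    forall y, V y -> ((r0 - 1)%:E < f y)%E.
  by apply: lscf; rewrite fx0E lte_fin; lra.
pose c := e / 2; have [c0 ce] : 0 < c /\ c < e by rewrite /c; lra.
exists x0, (r0 - 1), c^-1; split.
  by rewrite invr_ge0 ltW.
move=> y; have [->|fy] := eqVneq (f y) +oo%E; first exact: leey.
rewrite (Gamma0_fin Gf fy) lee_fin; set r := fine (f y).
have N0 := normr_ge0 (y - x0); have [Nc|cN] := lerP `|y - x0| c.
  have : ((r0 - 1)%:E < f y)%E.
    by apply/Vr/eV; rewrite -ball_normE /= distrC; lra.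
  rewrite (Gamma0_fin Gf fy) lte_fin -/r.
  have : 0 <= c^-1 * `|y - x0| by rewrite mulr_ge0// invr_ge0 ltW.
  by move=> ? ?; lra.
(* t *: y + (1 - t) *: x0 is the point of the segment at distance c from x0. *)
have Npos : 0 < `|y - x0| by lra.
set t := c / `|y - x0|.
have tc : t * `|y - x0| = c by rewrite /t divfK// gt_eqF.
have t0 : 0 < t by rewrite divr_gt0.
have t1 : t <= 1 by rewrite ler_pdivrMr// mul1r ltW.
have [|s fw sle] := Gamma0_convex_fin (t := t) Gf _ (Gamma0_fin Gf fy) fx0E.
  by rewrite (ltW t0).
have : ((r0 - 1)%:E < f (t *: y + (1 - t) *: x0)%R)%E.
  apply/Vr/eV; rewrite -ball_normE /=.
  rewrite scalerBl scale1r addrCA opprD addNKr -scalerBr normrN normrZ.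
  by rewrite gtr0_norm// tc; lra.
rewrite fw lte_fin => h.
have tr : c^-1 * `|y - x0| = t^-1 by rewrite mulrC -invf_div.
rewrite tr -(ler_pM2l t0).
rewrite -/r in sle; rewrite !mulrBr divff ?gt_eqF//. nra.
Qed.

(** The quadratic term dominates the linear decrease that the cone of
    [Gamma0_conic_minorant] allows. *)
Lemma prox_objective_bounded f x : Gamma0 f ->
  exists L : R, forall y, (L%:E <= (2^-1 * `|x - y| ^+ 2)%:E + f y)%E.
Proof.
move=> Gf; have [x0 [a [b [b0 fab]]]] := Gamma0_conic_minorant Gf.
exists (a - b * `|x - x0| - 2^-1 * b ^+ 2) => y.
apply: (@le_trans _ _ ((2^-1 * `|x - y| ^+ 2)%:E + (a - b * `|y - x0|)%:E)%E).
  rewrite -EFinD lee_fin.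
  have : `|y - x0| <= `|x - y| + `|x - x0|.
    by rewrite (distrC x y) (le_trans _ (ler_normD _ _))// addrA subrK.
  by move=> h; have := sqr_ge0 (`|x - y| - b); nra.
by rewrite leeD2l.
Qed.

(** The direct method. By the parallelogram identity, two points whose values
    exceed the infimum by at most eps are within sqrt (8 eps) of each other,
    so a minimizing sequence is Cauchy; semi-continuity shows that its limit
    attains the infimum. *)
Lemma prox_exists f x : Gamma0 f ->
  exists p, argmin (fun y => (2^-1 * `|x - y| ^+ 2)%:E + f y)%E p.
Proof.
move=> Gf; have [[_ [x0 fx0]] _ lscf] := Gf.
have [L FL] := prox_objective_bounded x Gf.
pose D := [set y | f y != +oo%E].
pose F y := 2^-1 * `|x - y| ^+ 2 + fine (f y).
have FE y : D y -> ((2^-1 * `|x - y| ^+ 2)%:E + f y)%E = (F y)%:E.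
  by move=> Dy; rewrite (Gamma0_fin Gf Dy) -EFinD.
have lbF : has_lbound (F @` D).
  by exists L => _ [y Dy <-]; rewrite -lee_fin -FE.
have infF : has_inf (F @` D) by split=> //; exists (F x0); exists x0.
set m := inf (F @` D).
have mF y : D y -> m <= F y by move=> Dy; apply: ge_inf => //; exists y.
have /choice[y_ yP] : forall n : nat, exists y, D y /\ F y < m + n.+1%:R^-1.
  move=> n; have [|_ [y Dy <-] ?] := @inf_adherent _ _ n.+1%:R^-1 _ infF.
    by rewrite invr_gt0.
  by exists y.
have near_min u v (eps : R) : D u -> D v -> F u <= m + eps -> F v <= m + eps ->
    `|u - v| ^+ 2 <= 8 * eps.
  move=> Du Dv Fu Fv.
  have [|s fs sle] := Gamma0_convex_fin (t := 2^-1) Gf _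
    (Gamma0_fin Gf Du) (Gamma0_fin Gf Dv); first by lra.
  set w := _ + _ in fs; have Dw : D w by rewrite /D /= fs.
  have := mF _ Dw; rewrite /F fs /=.
  have : `|x - w| ^+ 2 =
      2^-1 * `|x - u| ^+ 2 + 2^-1 * `|x - v| ^+ 2 - 4^-1 * `|u - v| ^+ 2.
    rewrite -!inner_normE /w !innerE (innerC u x) (innerC v x) (innerC v u).
    by field.
  by move: Fu Fv; rewrite /F; lra.
have yle n k : (n <= k)%N -> F (y_ k) <= m + n.+1%:R^-1.
  move=> nk; rewrite (le_trans (ltW (yP k).2))// lerD2l lef_pV2 ?posrE//.
  by rewrite ler_nat.
have : cvg (y_ @ \oo).
  apply: cauchy_cvg; apply/cauchyP => e e0.
  have e80 : 0 < e ^+ 2 / 8 by rewrite divr_gt0// exprn_gt0.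
  have [N _ /(_ N (leqnn N)) /= Ne] := near_infty_natSinv_lt (PosNum e80).
  exists (y_ N); exists N => // n /= Nn; rewrite -ball_normE /=.
  rewrite -(@ltr_pXn2r _ 2)// ?nnegrE ?(ltW e0)//.
  have := near_min _ _ _ (yP N).1 (yP n).1 (yle _ _ (leqnn N)) (yle _ _ Nn).
  by move: Ne; set d := _^-1; lra.
move=> /cvg_ex[p yp].
have fp : (f p <= (m - 2^-1 * `|x - p| ^+ 2)%:E)%E.
  (* Otherwise f > b near p for some b above the bound, and the values of F
     along the sequence stay away from m. *)
  rewrite leNgt; apply/negP => afp.
  set a := m - _ in afp.
  have [b ab bfp] : exists2 b : R, a < b & (b%:E < f p)%E.
    case: (f p) afp => [r| |//]; rewrite ?lte_fin => ar.
      by exists ((a + r) / 2); rewrite ?lte_fin; lra.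
    by exists (a + 1); rewrite ?ltry// ltrDl.
  have [V pV Vb] := lscf _ _ bfp.
  have ba0 : 0 < (b - a) / 2 by lra.
  have cn : (2^-1 * `|x - y_ n| ^+ 2) @[n --> \oo] --> 2^-1 * `|x - p| ^+ 2.
    have cN : `|x - y_ n| @[n --> \oo] --> `|x - p|.
      by apply: cvg_norm; apply: cvgB => //; exact: cvg_cst.
    by apply: cvgMr; under eq_fun do rewrite expr2; exact: cvgM.
  have /cvgrPdist_lt/(_ _ ba0) n1 := cn.
  have n2 : \forall n \near \oo, V (y_ n) by apply: yp.
  have n3 := near_infty_natSinv_lt (PosNum ba0).
  have [n [[h1 h2] h3]] := filter_ex (filterI (filterI n1 n2) n3).
  have := Vb _ h2; rewrite (Gamma0_fin Gf (yP n).1) lte_fin => h4.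
  have aE : a = m - 2^-1 * `|x - p| ^+ 2 by [].
  move: h1 h3 (yP n).2; rewrite /= /F ltr_norml; set k := n.+1%:R^-1.
  by move: afp bfp => _ _ /andP[? ?] ? ?; lra.
exists p => y; apply: (@le_trans _ _ m%:E).
  have -> : m%:E =
      ((2^-1 * `|x - p| ^+ 2)%:E + (m - 2^-1 * `|x - p| ^+ 2)%:E)%E.
    by rewrite -EFinD addrCA subrr addr0.
  by rewrite leeD2l.
have [->|Dy] := eqVneq (f y) +oo%E; first by rewrite addey ?leey.
by rewrite FE// lee_fin; exact: mF.
Qed.

End ProximalPoints.

(** * Proximity operators and their Moreau envelopes *)

Section Envelopes.
Context {R : realType} {X : hilbertType R}.
Implicit Types (f : X -> \bar R) (e : X -> R) (A : X -> X).

(** Optimality: x - p is a subgradient of f at p. Comparing p with the points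
    p + t (y - p) gives the inequality up to an error of order t. *)
Lemma prox_subgradient f x p : Gamma0 f ->
  argmin (fun y => (2^-1 * `|x - y| ^+ 2)%:E + f y)%E p ->
  exists2 r, f p = r%:E &
    forall y, ((r + inner (x - p) (y - p))%:E <= f y)%E.
Proof.
move=> Gf pmin; have [[_ [x0 fx0]] _ _] := Gf.
have fp : f p != +oo%E.
  apply/negP => /eqP fp; have := pmin x0.
  by rewrite fp (Gamma0_fin Gf fx0) -EFinD addey// leye_eq.
exists (fine (f p)); first exact: Gamma0_fin.
move=> y; have [->|fy] := eqVneq (f y) +oo%E; first exact: leey.
have fpE := Gamma0_fin Gf fp; have fyE := Gamma0_fin Gf fy.
rewrite fyE lee_fin leNgt; apply/negP; rewrite -subr_gt0.
set d := fine (f p) + _ - _ => d0; set Q := inner (y - p) (y - p).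
have Q0 : 0 <= Q := inner_ge0 _.
(* If the inequality fails by d > 0, minimality of p along the segment forces
   d <= t Q / 2 for all t in ]0, 1]; this t is a value that contradicts it. *)
pose t := d / (d + Q).
have dQ0 : 0 < d + Q by rewrite ltr_wpDr.
have t0 : 0 < t by rewrite divr_gt0.
have t1 : t <= 1 by rewrite ler_pdivrMr// mul1r lerDl.
have tE : t * (d + Q) = d by rewrite divfK// gt_eqF.
have [|s fs sle] := Gamma0_convex_fin (t := t) Gf _ fyE fpE.
  by rewrite (ltW t0).
have := pmin (t *: y + (1 - t) *: p); rewrite fs fpE -!EFinD lee_fin.
have -> : x - (t *: y + (1 - t) *: p) = (x - p) - t *: (y - p).
  by rewrite scalerBl scalerBr scale1r addrCA opprD addrA.
rewrite -!inner_normE; move: d0 tE sle; rewrite /d.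
have -> : inner (x - p - t *: (y - p)) (x - p - t *: (y - p)) =
    inner (x - p) (x - p) - 2 * t * inner (x - p) (y - p) + t ^+ 2 * Q.
  by rewrite /Q; move: (x - p) (y - p) => u v;
    rewrite !innerE (innerC v u); ring.
move: (inner (x - p) (y - p)) (inner (x - p) (x - p)) => c N.
move: (fine (f p)) (fine (f y)) => r r'.
move=> d0 tE sle h.
have : t * (r + c - r') <= t * (t * Q / 2) by nra.
by rewrite ler_pM2l//; nra.
Qed.

(** In an envelope pair, e is convex with gradient x - A x at x, and this
    gradient is 1-Lipschitz; the model is the Moreau envelope of f together
    with the proximity operator of f. *)
Definition envelope_pair e A := forall x z,
  e x + inner (x - A x) (z - x) <= e z
    <= e x + inner (x - A x) (z - x) + 2^-1 * `|z - x| ^+ 2.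

Lemma proxP f x : Gamma0 f ->
  argmin (fun y => (2^-1 * `|x - y| ^+ 2)%:E + f y)%E (prox f x).
Proof. by move=> Gf; apply: getPex; exact: prox_exists. Qed.

(** The upper bound compares the value at z with that of the competitor
    prox f x. The lower bound bounds f below by its affine minorant at
    prox f x; the remaining quadratic term is a square. *)
Lemma prox_envelope f : Gamma0 f -> exists e, envelope_pair e (prox f).
Proof.
move=> Gf; exists (fun x => 2^-1 * `|x - prox f x| ^+ 2 + fine (f (prox f x))).
move=> x z; have [r fp subr] := prox_subgradient Gf (proxP x Gf).
have [s fq _] := prox_subgradient Gf (proxP z Gf).
have := proxP z Gf (prox f x); have := subr (prox f z).
rewrite fp fq -!EFinD !lee_fin /=.
move: (prox f x) (prox f z) => p q rs zq; apply/andP; split; last first.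
  apply: (le_trans zq); rewrite -!inner_normE !innerE.
  by rewrite (innerC z x) (innerC z p) (innerC p x); lra.
have := inner_ge0 ((z - q) - (x - p)); move: rs; rewrite -!inner_normE !innerE.
rewrite (innerC z x) (innerC z p) (innerC p x) (innerC q x) (innerC q p).
by rewrite (innerC q z); lra.
Qed.

(** Moreau's characterization. The function whose proximity operator is A is
      g p = sup_z (e z - |z - p|^2 / 2).
    Replacing e z by its affine minorants
    e x + <x - A x, z - x> and maximizing over z turns g into the supremum
    over x of the affine functions
      h x p = e x + |x - A x|^2 / 2 + <x - A x, p - x>.
    Completing the square in |x - p|^2 / 2 + h x p shows that the proximal
    objective of g at x is at least e x + |p - A x|^2 / 2, so A x is the only
    possible minimizer once the value e x is attained there. *)
Lemma envelope_prox e A : envelope_pair e A -> is_proximity_operator X A.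
Proof.
move=> eA.
pose h x p := e x + 2^-1 * `|x - A x| ^+ 2 + inner (x - A x) (p - x).
pose g p := ereal_sup (range (fun x => (h x p)%:E)).
have hE x p : 2^-1 * `|x - p| ^+ 2 + h x p = e x + 2^-1 * `|p - A x| ^+ 2.
  rewrite /h -!inner_normE !innerE.
  by rewrite (innerC p x) (innerC (A x) x) (innerC (A x) p); field.
have hg x p : ((h x p)%:E <= g p)%E by apply: ereal_sup_ubound; exists x.
have gA x : (g (A x) <= (e x - 2^-1 * `|x - A x| ^+ 2)%:E)%E.
  apply: ge_ereal_sup => _ [z _ <-]; rewrite lee_fin /h.
  (* h z (A x) is the maximum over w of the affine minorant of e at z minus
     |w - A x|^2 / 2; this w is the maximizer. *)
  pose w := A x + (z - A z).
  have /andP[zw _] := eA z w; have /andP[_ wx] := eA x w.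
  have := le_trans zw wx; rewrite -!inner_normE /w.
  have -> : A x + (z - A z) - z = A x - A z by rewrite addrA addrAC addrK.
  have -> : A x + (z - A z) - x = (z - A z) - (x - A x).
    by rewrite opprB [RHS]addrCA [RHS]addrA.
  have -> : A x - z = (A x - A z) - (z - A z) by rewrite opprB addrA subrK.
  move: (z - A z) (x - A x) (A x - A z) => a b c.
  by rewrite !innerE (innerC b a); lra.
have gmin x : ((2^-1 * `|x - A x| ^+ 2)%:E + g (A x) <= (e x)%:E)%E.
  by rewrite -leeBrDl// -EFinB.
have gNy p : g p != -oo%E.
  by rewrite -ltNye (lt_le_trans _ (hg 0 p))// ltNyr.
exists g; first split.
- split=> //; exists (A 0).
  by rewrite -ltey (le_lt_trans (gA 0))// ltry.
- move=> t x y /andP[t0 t1]; apply: ge_ereal_sup => _ [z _ <-].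
  apply: (@le_trans _ _ (t%:E * (h z x)%:E + (1 - t)%:E * (h z y)%:E)%E).
    by rewrite -!EFinM -EFinD lee_fin /h !innerE; lra.
  by apply: leeD; apply: lee_wpmul2l; rewrite ?hg// lee_fin ?subr_ge0.
- apply: lsc_sup => x; apply: (@lsc_lipschitz _ _ `|x - A x|) => p q.
  rewrite (_ : _ - _ = inner (x - A x) (q - p)) ?cauchy_schwarz//.
  by rewrite /h !innerE; ring.
apply/funext => x; apply/esym/get_unique.
  move=> y; apply: (le_trans (gmin x)).
  apply: (@le_trans _ _ ((2^-1 * `|x - y| ^+ 2)%:E + (h x y)%:E)%E).
    by rewrite -EFinD hE lee_fin lerDl mulr_ge0// sqr_ge0.
  by rewrite leeD2l.
move=> y /(_ (A x)) /le_trans /(_ (gmin x)) yx.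
have : ((2^-1 * `|x - y| ^+ 2)%:E + (h x y)%:E <= (e x)%:E)%E.
  by apply: le_trans yx; rewrite leeD2l.
rewrite -EFinD hE lee_fin gerDl pmulr_rle0// => h0.
apply/eqP; rewrite -subr_eq0 -normr_eq0 -sqrf_eq0.
by rewrite eq_le h0 sqr_ge0.
Qed.

End Envelopes.

(** * The Riesz representation theorem *)

Section Riesz.
Context {R : realType} {X : hilbertType R}.

(** The representing vector is the proximal point of -l at 0: its subgradient
    inequality at p + v and at p - v gives both inequalities between l v and
    <v, p>. *)
Lemma riesz (l : X -> R) (M : R) : scalar l ->
  (forall x, `|l x| <= M * `|x|) -> exists z, forall x, l x = inner x z.
Proof.
move=> l_lin lM.
have lD x y : l (x + y) = l x + l y by rewrite -[x]scale1r l_lin scale1r mul1r.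
have l0 : l 0 = 0 by have := lD 0 0; rewrite addr0; lra.
have lZ t x : l (t *: x) = t * l x by rewrite -[t *: x]addr0 l_lin l0 addr0.
have lN x : l (- x) = - l x by rewrite -scaleN1r lZ mulN1r.
have Gl : Gamma0 (fun x => (- l x)%:E).
  split.
  - by split=> //; exists 0.
  - move=> t x y _ /=; rewrite -!EFinM -EFinD lee_fin lD !lZ.
    by lra.
  - apply: (@lsc_lipschitz _ _ M) => x y.
    by rewrite -opprD normrN -lN -lD.
have [p /(prox_subgradient Gl)[_ [<-] subl]] := prox_exists 0 Gl.
exists p => v; apply/eqP; rewrite eq_le innerC.
have := subl (p - v); have := subl (p + v).
rewrite !lee_fin !lD lN sub0r !innerE => *; apply/andP; split; lra.
Qed.

End Riesz.

(** * Adjoint and Moore-Penrose inverse *)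

Section MoorePenrose.
Context {R : realType} {H K : hilbertType R} (T : {linear H -> K}).

Lemma adjointP : bounded_operator T ->
  forall x y, inner (T x) y = inner x (adjoint T y).
Proof.
move=> [M TM] x y.
apply: (@getPex _ [set z | forall x, inner (T x) y = inner x z]).
apply: (@riesz _ _ _ (M * `|y|)).
  by move=> a u v; rewrite linearP !innerE.
move=> u; rewrite (le_trans (cauchy_schwarz _ _))// mulrAC.
by rewrite ler_wpM2r.
Qed.

(** T (T^+ y) is the orthogonal projection of y onto the range of T. The
    functional x |-> <T x, y> is bounded on the Hilbert space H_T, hence
    represented there by some z; then T^* T z = T^* y, and z is T^+ y because
    T^* T is injective. *)
Lemma moore_penroseP : bounded_operator T -> injective T ->
  closed (range T) -> forall x y,
  inner (T x) (T (moore_penrose T y)) = inner (T x) y.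
Proof.
move=> Tbnd Tinj Tcl x y; have TadjE := adjointP Tbnd.
have [z zP] : exists z : renormed Tinj Tcl,
    forall x : renormed Tinj Tcl, inner (T x) y = inner x z.
  apply: (@riesz _ _ _ `|y|).
    by move=> a u v; rewrite linearP !innerE.
  by move=> u; rewrite mulrC renormed_normE cauchy_schwarz.
have adjz : adjoint T (T z) = adjoint T y.
  by apply: inner_ext => u; rewrite -!TadjE zP renormed_innerE.
have inj : injective (adjoint T \o T).
  move=> u v /= uv; apply: (Tinj); apply/eqP; rewrite -subr_eq0 -normr_eq0.
  rewrite -sqrf_eq0 -inner_normE -{1}linearB !innerE !TadjE.
  by rewrite uv subrr.
rewrite /moore_penrose /= -adjz -/((adjoint T \o T) z) pinvKV ?inE//.
  by move=> u v _ _; exact: inj.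
Qed.

End MoorePenrose.


(** * Proximity operators on the renormed space *)

Theorem theorem3p1 (R : realType) (H K : hilbertType R) (T : {linear H -> K})
    (Tbounded : bounded_operator T) (Tinj : injective T)
    (Tcl : closed (range T)) (Prox : K -> K)
    (hProx : is_proximity_operator K Prox) :
  is_proximity_operator (renormed Tinj Tcl) (moore_penrose T \o Prox \o T).
Proof.
case: hProx => f Gf ->; have [e eP] := prox_envelope Gf.
apply: (@envelope_prox R (renormed Tinj Tcl) (e \o T)) => x z.
have := eP (T x) (T z); rewrite -linearB -renormed_normE.
(* The gradients of e at T x and of e \o T at x agree against z - x. *)
suff -> : inner (T x - prox f (T x)) (T (z - x)) =
    @inner R (renormed Tinj Tcl)
      (x - (moore_penrose T \o prox f \o T) x) (z - x) by [].
rewrite renormed_innerE (linearB T x) [LHS]linearBl [RHS]linearBl /=.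
congr (_ - _); rewrite innerC -(moore_penroseP Tbounded Tinj Tcl).
exact: innerC.
Qed.
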